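(* Let $n\ge p\ge 1$ be integers, let $St_p^n=\{U\in\mathcal{M}_{n\times p}(\mathbb{R}) : U^tU=\mathbb{I}_p\}$ be the orthogonal Stiefel manifold with the Riemannian metric induced by the Frobenius metric on $\mathcal{M}_{n\times p}(\mathbb{R})$, and let $\Delta_{St_p^n}$ be its Laplace--Beltrami operator. Let $\widetilde{f}:St_p^n\to\mathbb{R}$ be a smooth function and let $f:\mathcal{M}_{n\times p}(\mathbb{R})\to\mathbb{R}$ be a smooth prolongation of $\widetilde f$, i.e. a smooth function with $f|_{St_p^n}=\widetilde f$. Then for every $U\in St_p^n$, $$\Delta_{St_p^n}\widetilde{f}(U)=\Delta f(U)-\left(n-\frac{p+1}{2}\right)\operatorname{tr}\left(U^t\nabla f(U)\right)-\frac12\operatorname{tr}\Big(\big(\mathbb{I}_p\otimes(UU^t)+\Lambda(U)\big)\,\mathrm{Hess} f(U)\Big),$$ where $\Lambda(U)$ is the $np\times np$ block matrix whose $(i,j)$ block, $1\le i,j\le p$, is the $n\times n$ matrix $\mathbf{u}_j\mathbf{u}_i^t$, with $\mathbf{u}_1,\dots,\mathbf{u}_p\in\mathbb{R}^n$ the columns of $U$.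
   Context: $\mathcal{M}_{n\times p}(\mathbb{R})$ is the space of real $n\times p$ matrices with the Frobenius (Euclidean) metric $\langle A,B\rangle=\operatorname{tr}(A^tB)$; $St_p^n$ is regarded as an embedded submanifold with the induced Riemannian metric. $\mathbb{I}_k$ is the $k\times k$ identity matrix, $^t$ denotes transpose, and $\otimes$ is the Kronecker product, so $\mathbb{I}_p\otimes(UU^t)$ is the $np\times np$ block diagonal matrix with $p$ diagonal blocks equal to $UU^t$. The Laplace--Beltrami operator of a Riemannian manifold $(S,\mathbf{g})$ is taken with the sign convention $\Delta_S\widetilde f=\operatorname{tr}\left([\mathbf{g}]^{-1}[\mathrm{Hess}_S\widetilde f]\right)$, i.e. the metric trace of the Riemannian Hessian of $\widetilde f$. $\mathrm{vec}(U)\in\mathbb{R}^{np}$ denotes the column vectorization of $U\in\mathcal{M}_{n\times p}(\mathbb{R})$ (the columns $\mathbf{u}_1,\dots,\mathbf{u}_p$ stacked in order). For a smooth $f:\mathcal{M}_{n\times p}(\mathbb{R})\to\mathbb{R}$, put $\widehat f=f\circ\mathrm{vec}^{-1}:\mathbb{R}^{np}\to\mathbb{R}$. Then: - $\nabla f(U)=\mathrm{vec}^{-1}\big(\nabla\widehat f(\mathrm{vec}(U))\big)\in\mathcal{M}_{n\times p}(\mathbb{R})$, the matrix with entries $\partial f/\partial u_{ij}(U)$; - $\mathrm{Hess} f(U)$ is the $np\times np$ Euclidean Hessian matrix of $\widehat f$ at $\mathrm{vec}(U)$, viewed as a $p\times p$ array of $n\times n$ blocks whose $(i,j)$ block is $\left[\frac{\partial^2\widehat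 f}{\partial u_{ki}\partial u_{lj}}(\mathrm{vec}(U))\right]_{1\le k,l\le n}$; - $\Delta f(U)=\Delta\widehat f(\mathrm{vec}(U))$ is the Euclidean Laplacian, i.e. the trace of $\mathrm{Hess} f(U)$. *)

(* Defs.v *)
From HB Require Import structures.
From mathcomp Require Import all_boot all_order all_algebra.
From mathcomp Require Import all_classical all_reals all_analysis.
From mathcomp Require Export mxtens.

Set Implicit Arguments.
Unset Strict Implicit.
Unset Printing Implicit Defensive.

Import Order.TTheory GRing.Theory Num.Theory.
Import numFieldNormedType.Exports.

Local Open Scope classical_set_scope.
Local Open Scope ring_scope.

(* For V open, [smooth_on V f] is C^infinity regularity of f on V.  The values
   of 'D_v f outside V are irrelevant: every condition is at a point of V, and
   is local. *)
Fixpoint Ck_on (R : realType) (E F : normedModType R) (V : set E)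
    (k : nat) (f : E -> F) : Prop :=
  match k with
  | 0 => forall x, V x -> {for x, continuous f}
  | k'.+1 => (forall x, V x -> differentiable f x) /\
             forall v : E, Ck_on V k' (fun x => 'D_v f x)
  end.

Definition smooth_on (R : realType) (E F : normedModType R) (V : set E)
    (f : E -> F) : Prop :=
  forall k, Ck_on V k f.

Section Coordinates.
Variables (R : realType) (d : nat).

Definition partial (F : normedModType R) (i : 'I_d) (f : 'cV[R]_d -> F) :
    'cV[R]_d -> F :=
  fun x => 'D_(delta_mx i 0) f x.

Definition euclidean_gradient (h : 'cV[R]_d -> R) (x : 'cV[R]_d) : 'cV[R]_d :=
  \col_i partial i h x.

Definition euclidean_hessian (h : 'cV[R]_d -> R) (x : 'cV[R]_d) : 'M[R]_d :=
  \matrix_(i, j) partial i (partial j h) x.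

(* Below, g is a Riemannian metric in coordinates: g x = [g_ij(x)]. *)
Variable g : 'cV[R]_d -> 'M[R]_d.

(* Gamma^k_ij of the Levi-Civita connection of g *)
Definition christoffel (k i j : 'I_d) (x : 'cV[R]_d) : R :=
  2^-1 * \sum_l invmx (g x) k l *
    (partial i (fun y => g y j l) x + partial j (fun y => g y i l) x
     - partial l (fun y => g y i j) x).

(* (Hess h)(d_i, d_j) = d_i (d_j h) - (nabla_{d_i} d_j) h *)
Definition riemannian_hessian (h : 'cV[R]_d -> R) (x : 'cV[R]_d) : 'M[R]_d :=
  \matrix_(i, j) (partial i (partial j h) x
                  - \sum_k christoffel k i j x * partial k h x).

Definition coord_laplace_beltrami (h : 'cV[R]_d -> R) (x : 'cV[R]_d) : R :=
  \tr (invmx (g x) *m riemannian_hessian h x).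

End Coordinates.

Section Submanifold.
Variables (R : realType) (n p : nat).

Definition frobenius (A B : 'M[R]_(n, p)) : R := \tr (A^T *m B).

(* S is a subset of matrix space, meant to be an embedded submanifold of
   dimension d; as a type it carries the subspace topology. *)
Variables (d : nat) (S : set 'M[R]_(n, p)).

(* phi, restricted to V, is a smooth immersion and a homeomorphism onto an
   open subset of S.  Its values outside V are irrelevant. *)
Definition local_parametrization (V : set 'cV[R]_d) (phi : 'cV[R]_d -> S) :
    Prop :=
  [/\ open V,
      smooth_on V (fun x => \val (phi x)),
      forall x, V x -> injective ('d (fun y => \val (phi y)) x),
      set_inj V phi &
      forall W : set 'cV[R]_d, open W -> W `<=` V -> open (phi @` W)].

Definition smooth_function (f : S -> R) : Prop :=
  forall V phi, local_parametrization V phi ->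
    smooth_on V (fun x => f (phi x) : R).

Definition induced_metric (phi : 'cV[R]_d -> S) (x : 'cV[R]_d) : 'M[R]_d :=
  \matrix_(i, j) frobenius (partial i (fun y => \val (phi y)) x)
                           (partial j (fun y => \val (phi y)) x).

(* The common value at U of the coordinate expression
   tr([g]^-1 [Hess f]) in all local parametrizations around U. *)
Definition laplace_beltrami (f : S -> R) (U : S) : R :=
  get [set l : R | forall V phi x,
    local_parametrization V phi -> V x -> phi x = U ->
    l = coord_laplace_beltrami (induced_metric phi) (fun y => f (phi y)) x].

End Submanifold.

Section MatrixSpace.
Variables (R : realType) (n p : nat).

(* 'I_(p * n) is identified with 'I_p * 'I_n by mxtens_index, as in the
   Kronecker product *t: (i, k) is position k of block i, so that the columns
   of a matrix are stacked in order. *)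
Definition vec (U : 'M[R]_(n, p)) : 'cV[R]_(p * n) :=
  \col_a U (mxtens_unindex a).2 (mxtens_unindex a).1.

Definition unvec (v : 'cV[R]_(p * n)) : 'M[R]_(n, p) :=
  \matrix_(k, i) v (mxtens_index (i, k)) 0.

Lemma vecK : cancel vec unvec.
Proof. by move=> U; apply/matrixP=> k i; rewrite !mxE mxtens_indexK. Qed.

Lemma unvecK : cancel unvec vec.
Proof.
by move=> v; apply/colP=> a; rewrite !mxE -surjective_pairing mxtens_unindexK.
Qed.

Definition gradient (f : 'M[R]_(n, p) -> R) (U : 'M[R]_(n, p)) : 'M[R]_(n, p) :=
  unvec (euclidean_gradient (f \o unvec) (vec U)).

Definition hessian (f : 'M[R]_(n, p) -> R) (U : 'M[R]_(n, p)) : 'M[R]_(p * n) :=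
  euclidean_hessian (f \o unvec) (vec U).

Definition laplacian (f : 'M[R]_(n, p) -> R) (U : 'M[R]_(n, p)) : R :=
  \tr (hessian f U).

Definition stiefel : set 'M[R]_(n, p) := [set U | U^T *m U = 1%:M].

Definition stiefel_dim : nat := (n * p - (p * p.+1)./2)%N.

Definition Lambda (U : 'M[R]_(n, p)) : 'M[R]_(p * n) :=
  \matrix_(a, b)
    let: (i, k) := mxtens_unindex a in
    let: (j, l) := mxtens_unindex b in
    (col j U *m (col i U)^T) k l.

End MatrixSpace.

Arguments stiefel : clear implicits.

(* Main.v *)
(* In a chart Phi with Jacobian J and metric g = J^T J, the trace of g^-1 Hess is
   tr(Pi Hess f) + sum_ij g^ij <grad f, (1 - Pi) d_i d_j Phi>, where
   Pi = J g^-1 J^T is the orthogonal projector onto the tangent space; this uses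
   the symmetry of second derivatives to simplify the Christoffel symbols.  For
   the Stiefel manifold a rank count identifies Pi with the explicit projector
   1 - (1 *t U U^T + Lambda U) / 2, and differentiating Phi^T Phi = 1 twice
   expresses the normal part of d_i d_j Phi through first derivatives, whose
   metric trace is a partial trace of Pi.  Since the Laplace-Beltrami operator is
   the common value in all charts, one chart around each point is also needed:
   a Cayley transform, which is rational with a rational inverse and therefore
   avoids the inverse function theorem. *)
From HB Require Import structures.
Require Import Defs.
From mathcomp Require Import all_boot all_order all_algebra.
From mathcomp Require Import all_classical all_reals all_analysis.
From mathcomp Require Import ring lra.

Set Implicit Arguments.
Unset Strict Implicit.
Unset Printing Implicit Defensive.

Import Order.TTheory GRing.Theory Num.Theory.
Import numFieldNormedType.Exports.
Local Open Scope classical_set_scope.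
Local Open Scope ring_scope.

(** * Symmetry of second derivatives *)

Section Schwarz.
Context {R : realType} {E : normedModType R}.

Lemma derivable_line (f : E -> R) (u y : E) (s : R) :
  derivable f (s *: u + y) u ->
  is_derive s 1 (fun r => f (r *: u + y)) ('D_u f (s *: u + y)).
Proof.
have eqf : (fun h : R => h^-1 *: (((fun r => f (r *: u + y)) \o shift s) (h *: 1)
     - f (s *: u + y))) =
  (fun h => h^-1 *: ((f \o shift (s *: u + y)) (h *: u) - f (s *: u + y))).
  by apply/funext => h /=; rewrite [h *: 1]mulr1 scalerDl addrA.
by move=> df; apply: DeriveDef; rewrite /derivable /derive eqf.
Qed.

(** The mean value theorem along [u], applied to [F (s *: u + (t *: v + x)) - F (s *: u + x)] as a
    function of [s], turns the second difference into [t] times an increment of ['D_u F]. The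
    first-order expansion of ['D_u F] at [x] evaluates that increment. *)
Lemma second_difference_approx (F : E -> R) (x u v : E) (e : R) : 0 < e ->
  (\forall y \near x, differentiable F y) -> differentiable ('D_u F) x ->
  \forall t \near 0^'+,
    `|F (t *: u + (t *: v + x)) - F (t *: u + x) - (F (t *: v + x) - F x)
      - t ^+ 2 * 'D_v ('D_u F) x| <= e * t ^+ 2.
Proof.
move=> e0 dF dDu.
have [d1 /= d10 dF1] := (nbhs_ballP _ _).1 dF.
(* [t * N] bounds the norm of [s *: u + k *: v] for [s] and [k] in [[0, t]]. Two expansion errors of
   size [e / (2 * N) * (t * N)] add up to [e * t], and the factor [t] from the mean value theorem
   gives [e * t ^+ 2]. *)
pose N := `|u| + `|v| + 1.
have N0 : 0 < N by rewrite /N; have := normr_ge0 u; have := normr_ge0 v; lra.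
have e'0 : 0 < e / (2 * N) by rewrite divr_gt0// mulr_gt0.
have := diff_locally dDu => /eqaddoP/(_ _ e'0) /nbhs_ballP[d2 /= d20 dD].
have d0 : 0 < Num.min d1 d2 by rewrite lt_min d10.
have dN0 : 0 < Num.min d1 d2 / N by rewrite divr_gt0.
near=> t.
have t0 : 0 < t by near: t; exact: nbhs_right_gt.
have td : t < Num.min d1 d2 / N by near: t; exact: nbhs_right_lt.
have small (s k : R) : 0 <= s <= t -> 0 <= k <= t -> `|s *: u + k *: v| <= t * N.
  move=> /andP[s0 st] /andP[k0 kt]; rewrite (le_trans (ler_normD _ _))// !normrZ.
  rewrite !ger0_norm// /N !mulrDr mulr1.
  have := ler_wpM2r (normr_ge0 u) st; have := ler_wpM2r (normr_ge0 v) kt.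
  by lra.
have tNd : t * N < Num.min d1 d2 by rewrite -ltr_pdivlMr.
have inb1 (s k : R) : 0 <= s <= t -> 0 <= k <= t ->
    differentiable F (s *: u + k *: v + x).
  move=> sb kb; apply: dF1; rewrite /ball_ -ball_normE /= distrC addrK.
  by rewrite (le_lt_trans (small _ _ sb kb))// (lt_le_trans tNd)// ge_min lexx.
have inb2 (s k : R) : 0 <= s <= t -> 0 <= k <= t ->
   `|'D_u F (s *: u + k *: v + x) - 'D_u F x - 'd ('D_u F) x (s *: u + k *: v)| <=
   e / (2 * N) * (t * N).
  move=> sb kb; have := dD (s *: u + k *: v).
  rewrite /ball_ -ball_normE /= sub0r normrN opprD addrA => /(_ _)/le_trans; apply.
    by rewrite (le_lt_trans (small _ _ sb kb))// (lt_le_trans tNd)// ge_min lexx orbT.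
  by rewrite ler_wpM2l ?small// ltW.
pose G (s : R) := F (s *: u + (t *: v + x)) - F (s *: u + x).
have tt : 0 <= t <= t by rewrite lexx ltW.
have zt : 0 <= (0:R) <= t by rewrite lexx ltW.
have dG (s : R) : 0 <= s <= t ->
   is_derive s 1 G ('D_u F (s *: u + (t *: v + x)) - 'D_u F (s *: u + x)).
  move=> sb; apply: is_deriveB; apply: derivable_line; apply: diff_derivable.
    by rewrite addrA; exact: inb1.
  by have := inb1 _ 0 sb zt; rewrite scale0r addr0.
have [||c] := @MVT R G
  (fun s => 'D_u F (s *: u + (t *: v + x)) - 'D_u F (s *: u + x)) 0 t t0.
- by move=> s; rewrite in_itv /= => /andP[/ltW s0 /ltW st]; apply: dG; rewrite s0.
- apply: derivable_within_continuous => s; rewrite in_itv /= => sb.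
  by have [] := dG _ sb.
rewrite in_itv /= => /andP[/ltW c0 /ltW ct]; have cb : 0 <= c <= t by rewrite c0.
rewrite /G scale0r !add0r subr0 => ->.
have eA : c *: u + t *: v + x = c *: u + (t *: v + x) by rewrite addrA.
have := inb2 _ _ cb tt; rewrite eA; have := inb2 _ 0 cb zt; rewrite scale0r addr0 linearD.
rewrite [in 'd _ _ (t *: v)]linearZ -(deriveE v dDu) /=.
have -> : e / (2 * N) * (t * N) = e * t / 2 by field; rewrite gt_eqF.
set a := 'D_u F (_ + (_ + x)); set b := 'D_u F (_ + x); set l := 'd _ _ _.
rewrite -[_ *: 'D_v _ x]/(t * 'D_v ('D_u F) x); set L := 'D_v _ _ => hb ha.
have -> : (a - b) * t - t ^+ 2 * L =
    ((a - 'D_u F x - (l + t * L)) - (b - 'D_u F x - l)) * t.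
  by ring.
rewrite normrM (gtr0_norm t0) expr2 mulrA ler_wpM2r ?(ltW t0)//.
by rewrite (le_trans (ler_normB _ _))//; lra.
Unshelve. all: by end_near. Qed.

(** The second difference is symmetric in [u] and [v], so for a common small [t] it lies within
    [e / 2 * t ^+ 2] of [t ^+ 2] times either mixed derivative. *)
Lemma deriveC (F : E -> R) (x u v : E) :
  (\forall y \near x, differentiable F y) ->
  differentiable ('D_u F) x -> differentiable ('D_v F) x ->
  'D_v ('D_u F) x = 'D_u ('D_v F) x.
Proof.
move=> dF dDu dDv; apply/eqP; rewrite -subr_eq0 -normr_le0.
apply/ler_addgt0Pr => e e0; rewrite add0r.
have e20 : 0 < e / 2 by rewrite divr_gt0.
have apx1 := second_difference_approx v e20 dF dDu.
have apx2 := second_difference_approx u e20 dF dDv.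
have [t [[h2 h1] t0]] := filter_ex (filterI (filterI apx1 apx2) (nbhs_right_gt 0)).
have t20 : 0 < t ^+ 2 by rewrite exprn_gt0.
move: h1 h2; rewrite (addrCA (t *: v)); set a := F _; set b := F _; set c := F _.
move: ('D_u ('D_v F) x) ('D_v ('D_u F) x) a b c => p q a b c h1 h2.
rewrite -(ler_pM2r t20) -(gtr0_norm t20) -normrM (gtr0_norm t20).
have -> : (q - p) * t ^+ 2 =
    (a - b - (c - F x) - t ^+ 2 * p) - (a - c - (b - F x) - t ^+ 2 * q).
  by ring.
rewrite (splitr e) mulrDl.
exact: (le_trans (ler_normB _ _) (lerD h1 h2)).
Qed.

End Schwarz.

(** * Closure properties of smooth functions *)

Section Smooth.
Context {R : realType} {E : normedModType R}.
Implicit Types (f g : E -> R) (k : nat).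

Lemma Ck_on_pred {F : normedModType R} (V : set E) k (f : E -> F) :
  Ck_on V k.+1 f -> Ck_on V k f.
Proof.
elim: k f => [f [df _] x Vx|k IH f [df dvf]].
  exact/differentiable_continuous/df.
by split=> // v; exact/IH/dvf.
Qed.

Lemma Ck_on_cst {F : normedModType R} (V : set E) k (c : F) :
  Ck_on V k (fun=> c).
Proof.
elim: k c => [c x _|k IH c]; first exact: cst_continuous.
split=> [x _|v]; first exact: differentiable_cst.
rewrite (_ : (fun x => 'D_v _ x) = fun=> 0); first exact: IH.
by apply/funext => x; rewrite derive_cst.
Qed.

Lemma Ck_onTD {F : normedModType R} k (f g : E -> F) :
  Ck_on setT k f -> Ck_on setT k g -> Ck_on setT k (fun x => f x + g x).
Proof.
elim: k f g => [f g cf cg x _|k IH f g [df Cf] [dg Cg]].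
  by apply: continuousD; [exact: cf|exact: cg].
split=> [x _|v]; first by apply: differentiableD; [exact: df|exact: dg].
rewrite (_ : (fun x => 'D_v _ x) = fun x => 'D_v f x + 'D_v g x).
  exact: IH (Cf v) (Cg v).
by apply/funext => x; rewrite deriveD//;
  [exact/diff_derivable/df|exact/diff_derivable/dg].
Qed.

Lemma Ck_onTM k f g :
  Ck_on setT k f -> Ck_on setT k g -> Ck_on setT k (fun x => f x * g x).
Proof.
elim: k f g => [f g cf cg x _|k IH f g Cf Cg].
  by apply: continuousM; [exact: cf|exact: cg].
have [[df Cdf] [dg Cdg]] := (Cf, Cg).
split=> [x _|v]; first by apply: differentiableM; [exact: df|exact: dg].
rewrite (_ : (fun x => 'D_v _ x) = fun x => f x * 'D_v g x + g x * 'D_v f x).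
  by apply: Ck_onTD; [exact: IH (Ck_on_pred Cf) (Cdg v) |
    exact: IH (Ck_on_pred Cg) (Cdf v)].
by apply/funext => x; rewrite deriveM//;
  [exact/diff_derivable/df|exact/diff_derivable/dg].
Qed.

Lemma Ck_onTV k f : (forall x, f x != 0) ->
  Ck_on setT k f -> Ck_on setT k (fun x => (f x)^-1).
Proof.
move=> f0; elim: k => [cf x _|k IH Cf].
  by apply: continuousV; [exact: f0|exact: cf].
have [df Cdf] := Cf.
split=> [x _|v]; first by apply: differentiableV; [exact: df|exact: f0].
rewrite (_ : (fun x => 'D_v _ x) = fun x => -1 * ((f x)^-1 * (f x)^-1) * 'D_v f x).
  have CV : Ck_on setT k (fun x => (f x)^-1) by exact/IH/Ck_on_pred.
  apply: Ck_onTM (Cdf v); apply: Ck_onTM; first exact: Ck_on_cst.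
  exact: Ck_onTM.
apply/funext => x; rewrite deriveV//; last exact/diff_derivable/df.
by rewrite /GRing.scale /= mulN1r -invfM expr2.
Qed.

Lemma differentiable_mx m n (M : E -> 'M[R]_(m, n)) x :
  (forall i j, differentiable (fun x => M x i j) x) -> differentiable M x.
Proof.
move=> dM.
rewrite (_ : M = \sum_i \sum_j fun x => M x i j *: delta_mx i j); last first.
  apply/funext => y; rewrite fct_sumE [LHS]matrix_sum_delta.
  by apply: eq_bigr => i _; rewrite fct_sumE.
do 2![apply: differentiable_sum => ?].
exact: differentiableZl.
Qed.

Lemma smooth_onT_mx m n (M : E -> 'M[R]_(m, n)) :
  (forall i j, smooth_on setT (fun x => M x i j)) -> smooth_on setT M.
Proof.
(* The entries are taken one order higher than [M], so that at [k = 0] continuity of [M] follows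
   from differentiability of its entries. *)
move=> sM k; have {sM} : forall i j, Ck_on setT k.+1 (fun x => M x i j).
  by move=> i j; exact: sM.
elim: k M => [M CM x _|k IH M CM].
  apply/differentiable_continuous/differentiable_mx => i j.
  by have [dM _] := CM i j; exact: dM.
have dM x : differentiable M x.
  by apply: differentiable_mx => i j; have [dM _] := CM i j; exact: dM.
split=> [//|v]; apply: IH => i j.
rewrite (_ : (fun x => 'D_v M x i j) = 'D_v (fun x => M x i j)).
  by have [_] := CM i j; exact.
by apply/funext => x; rewrite derive_mx ?mxE//; exact: diff_derivable.
Qed.

End Smooth.

Lemma smooth_onT_coord (R : realType) m n i j :
  smooth_on setT (fun x : 'M[R]_(m, n) => x i j).
Proof.
case=> [x _|k]; first exact: coord_continuous.
split=> [x _|v]; first exact: differentiable_coord.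
rewrite (_ : (fun x => 'D_v _ x) = fun=> v i j); first exact: Ck_on_cst.
apply/funext => x; have := @derive_mx _ _ m n id x v (@derivable_id _ _ x v).
by rewrite derive_id => /matrixP/(_ i j); rewrite mxE.
Qed.

(* Rational matrix expressions are treated once for the ring of smooth functions
   and once for that of functions differentiable at a point. *)
Section FunctionRing.
Context {R : comNzRingType} {T : Type}.

Record function_subring (P : (T -> R) -> Prop) : Prop := FunctionSubring {
  subring_cst : forall c, P (fun=> c);
  subring_add : forall f g, P f -> P g -> P (fun x => f x + g x);
  subring_mul : forall f g, P f -> P g -> P (fun x => f x * g x) }.

Definition entrywise (P : (T -> R) -> Prop) m n (M : T -> 'M[R]_(m, n)) : Prop :=
  forall i j, P (fun x => M x i j).

Context (P : (T -> R) -> Prop) (subP : function_subring P).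

Lemma subring_sum I (r : seq I) (Q : pred I) (F : I -> T -> R) :
  (forall i, P (F i)) -> P (fun x => \sum_(i <- r | Q i) F i x).
Proof.
move=> PF; elim: r => [|i r IH].
  by under eq_fun do rewrite big_nil; exact: subring_cst.
under eq_fun do rewrite big_cons; case: (Q i) => //.
exact: subring_add.
Qed.

Lemma subring_prod I (r : seq I) (Q : pred I) (F : I -> T -> R) :
  (forall i, P (F i)) -> P (fun x => \prod_(i <- r | Q i) F i x).
Proof.
move=> PF; elim: r => [|i r IH].
  by under eq_fun do rewrite big_nil; exact: subring_cst.
under eq_fun do rewrite big_cons; case: (Q i) => //.
exact: subring_mul.
Qed.

Lemma entrywise_cst m n (A : 'M[R]_(m, n)) : entrywise P (fun=> A).
Proof. by move=> i j; exact: subring_cst. Qed.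

Lemma entrywiseD m n (M N : T -> 'M[R]_(m, n)) :
  entrywise P M -> entrywise P N -> entrywise P (fun x => M x + N x).
Proof.
move=> PM PN i j; under eq_fun do rewrite mxE.
exact: subring_add.
Qed.

Lemma entrywiseZ m n (c : T -> R) (M : T -> 'M[R]_(m, n)) :
  P c -> entrywise P M -> entrywise P (fun x => c x *: M x).
Proof.
move=> Pc PM i j; under eq_fun do rewrite mxE.
exact: subring_mul.
Qed.

Lemma entrywiseB m n (M N : T -> 'M[R]_(m, n)) :
  entrywise P M -> entrywise P N -> entrywise P (fun x => M x - N x).
Proof.
move=> PM PN; apply: entrywiseD => //.
under eq_fun do rewrite -scaleN1r.
exact: (@entrywiseZ _ _ (fun=> -1)) (subring_cst subP (-1)) PN.
Qed.

Lemma entrywise_mul m n p (M : T -> 'M[R]_(m, n)) (N : T -> 'M[R]_(n, p)) :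
  entrywise P M -> entrywise P N -> entrywise P (fun x => M x *m N x).
Proof.
move=> PM PN i j; under eq_fun do rewrite mxE.
by apply: subring_sum => k; exact: subring_mul.
Qed.

Lemma entrywise_tr m n (M : T -> 'M[R]_(m, n)) :
  entrywise P M -> entrywise P (fun x => (M x)^T).
Proof. by move=> PM i j; under eq_fun do rewrite mxE; exact: PM. Qed.

Lemma subring_det n (M : T -> 'M[R]_n) :
  entrywise P M -> P (fun x => \det (M x)).
Proof.
move=> PM; apply: subring_sum => s; apply: subring_mul => //.
  exact: subring_cst.
by apply: subring_prod => i; exact: PM.
Qed.

Lemma entrywise_adj n (M : T -> 'M[R]_n) :
  entrywise P M -> entrywise P (fun x => \adj (M x)).
Proof.
move=> PM i j; under eq_fun do rewrite mxE.
apply: subring_mul => //; first exact: subring_cst.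
apply: subring_det => k l; under eq_fun do rewrite !mxE.
exact: PM.
Qed.

End FunctionRing.

Lemma smooth_function_subring (R : realType) (E : normedModType R) :
  function_subring (@smooth_on R E R setT).
Proof.
split=> [c k|f g sf sg k|f g sf sg k]; first exact: Ck_on_cst.
  exact: Ck_onTD.
exact: Ck_onTM.
Qed.

Lemma differentiable_function_subring (R : realType) (E : normedModType R) (x : E) :
  function_subring (fun f : E -> R => differentiable f x).
Proof.
split=> [c|f g df dg|f g df dg]; first exact: differentiable_cst.
  exact: differentiableD.
exact: differentiableM.
Qed.

(** * The Cayley transform on the Stiefel manifold *)

Lemma gram_eq0 (R : realType) m (y : 'cV[R]_m) : y^T *m y = 0 -> y = 0.
Proof.
move=> /matrixP/(_ 0 0); rewrite mxE [RHS]mxE => /eqP.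
rewrite psumr_eq0 => [/allP y0|j _]; last by rewrite mxE -expr2 sqr_ge0.
apply/colP => j; have := y0 j (mem_index_enum _).
by rewrite [y^T _ _]mxE mulf_eq0 orbb => /eqP ->; rewrite mxE.
Qed.

Section Cayley.
Context {R : realType} {n p : nat} (U : 'M[R]_(n, p)) (UU : U^T *m U = 1%:M).

(* Unlike [invmx], this is one rational expression on all matrices; it agrees
   with [invmx] on [unitmx] and has no meaning elsewhere. *)
Definition ratinv (A : 'M[R]_p) : 'M[R]_p := (\det A)^-1 *: \adj A.

Lemma ratinvE A : A \in unitmx -> ratinv A = invmx A.
Proof. by rewrite /invmx => ->. Qed.

(* For X = U A + B with A skew and U^T B = 0, the shift is F = B^T B - A, and
   cayley X = (U (1 - F) + 2 B) (1 + F)^-1; it is orthonormal because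
   F + F^T = 2 B^T B. *)
Definition cayley_shift (X : 'M[R]_(n, p)) : 'M[R]_p :=
  let B := X - U *m (U^T *m X) in B^T *m B - U^T *m X.

Definition cayley (X : 'M[R]_(n, p)) : 'M[R]_(n, p) :=
  let F := cayley_shift X in
  (U *m (1%:M - F) + (X - U *m (U^T *m X)) *+ 2) *m ratinv (1%:M + F).

(* If Y = cayley X then 1 + U^T Y = 2 (1 + F)^-1, so W = (1 + U^T Y)^-1 gives
   F = 2 W - 1, A = (F^T - F) / 2 = W^T - W and B = (Y - U U^T Y) W. *)
Definition cayley_log (Y : 'M[R]_(n, p)) : 'M[R]_(n, p) :=
  let W := ratinv (1%:M + U^T *m Y) in
  U *m (W^T - W) + (Y - U *m (U^T *m Y)) *m W.

(** The linearization at [U] of the equation defining the Stiefel manifold, hence its tangent space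
    at [U]; it says that [U^T *m X] is skew. *)
Definition tangent (X : 'M[R]_(n, p)) : Prop := U^T *m X + X^T *m U = 0.

(** If [v (1 + F) = 0], multiplying by [v^T] kills the skew term [U^T X] and leaves
    [v v^T + w w^T = 0] with [w = v B^T], a sum of two squares. *)
Lemma unitmx_cayley_shift X : tangent X -> 1%:M + cayley_shift X \in unitmx.
Proof.
move=> tX; rewrite -row_free_unit -kermx_eq0; apply/eqP/row_matrixP => i.
rewrite row0; move: (row i _) (row_sub i (kermx (1%:M + cayley_shift X))).
move=> v /sub_kermxP vM.
pose w := v *m (X - U *m (U^T *m X))^T.
have skew : v *m (U^T *m X) *m v^T = 0.
  have : v *m (U^T *m X) *m v^T = - (v *m (U^T *m X) *m v^T).
    have tr1 (a : 'M[R]_1) : a^T = a by apply/matrixP => ? ?; rewrite mxE !ord1.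
    rewrite -[LHS]tr1 !trmx_mul !trmxK -mulNmx -mulmxN mulmxA; congr (_ *m _ *m _).
    by apply/eqP; rewrite -subr_eq0 opprK addrC tX.
  by move/eqP; rewrite -subr_eq0 opprK -mulr2n -scaler_nat scaler_eq0 pnatr_eq0 => /eqP.
have sq m (y : 'rV[R]_m) : 0 <= (y *m y^T) 0 0.
  by rewrite mxE sumr_ge0// => j _; rewrite mxE -expr2 sqr_ge0.
have : v *m v^T + w *m w^T = 0.
  move: (congr1 (mulmxr v^T) vM); rewrite /= mul0mx /cayley_shift.
  rewrite mulmxDr mulmxBr mulmxDl mulmxBl skew subr0 mulmx1 => <-.
  by rewrite /w trmx_mul trmxK !mulmxA.
move=> /matrixP/(_ 0 0); rewrite mxE [RHS]mxE => /eqP.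
rewrite paddr_eq0// => /andP[/eqP v0 _].
apply/trmx_inj; rewrite trmx0; apply: gram_eq0.
by rewrite trmxK; apply/matrixP => a b; rewrite !ord1 v0 mxE.
Qed.

Lemma mulmx_residual0 (X : 'M[R]_(n, p)) : U^T *m (X - U *m (U^T *m X)) = 0.
Proof. by rewrite mulmxBr !mulmxA UU mul1mx subrr. Qed.

Lemma cayley_shiftD X : tangent X ->
  let B := X - U *m (U^T *m X) in
  cayley_shift X + (cayley_shift X)^T = B^T *m B *+ 2.
Proof.
move=> tX; rewrite /cayley_shift /=; move: (X - _) => B.
rewrite linearB /= !trmx_mul !trmxK.
by rewrite addrACA -opprD tX subr0 mulr2n.
Qed.

(** The numerator has Gram matrix [(1 - F)^T (1 - F) + 4 B^T B], because the cross terms vanish. The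
    relation on [F + F^T] turns it into [(1 + F)^T (1 + F)], which the inverse factors cancel. *)
Lemma cayley_isometry (B : 'M[R]_(n, p)) (F : 'M[R]_p) : U^T *m B = 0 ->
  F + F^T = B^T *m B *+ 2 -> 1%:M + F \in unitmx ->
  let Y := (U *m (1%:M - F) + B *+ 2) *m invmx (1%:M + F) in Y^T *m Y = 1%:M.
Proof.
move=> UB FD uF /=.
have BU : B^T *m U = 0 by rewrite -[B^T *m U]trmxK trmx_mul trmxK UB trmx0.
rewrite trmx_mul -mulmxA (mulmxA (_ + _)^T).
suff -> : (U *m (1%:M - F) + B *+ 2)^T *m (U *m (1%:M - F) + B *+ 2) =
          (1%:M + F)^T *m (1%:M + F).
  by rewrite -(mulmxA (1%:M + F)^T) mulmxV// mulmx1 -trmx_mul mulmxV// trmx1.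
have -> : (U *m (1%:M - F) + B *+ 2)^T = (1%:M - F)^T *m U^T + B^T *+ 2.
  by rewrite linearD linearMn /= trmx_mul.
have -> : ((1%:M - F)^T *m U^T + B^T *+ 2) *m (U *m (1%:M - F) + B *+ 2) =
    (1%:M - F)^T *m (1%:M - F) + B^T *m B *+ 2 *+ 2.
  move: (1%:M - F) => G.
  rewrite !mulr2n !(mulmxDl, mulmxDr) -!mulmxA UB.
  rewrite (mulmxA U^T) UU mul1mx (mulmxA B^T) BU.
  by rewrite mulmx0 mul0mx !(add0r, addr0).
rewrite -FD !linearD /= linearN /= trmx1.
rewrite !(mulmxDl, mulmxDr, mulNmx, mulmxN, mul1mx, mulmx1).
move: (F^T *m F) F^T 1%:M => H G I; apply/matrixP => i j; rewrite !mxE; ring.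
Qed.

Lemma cayley_stiefel X : tangent X -> (cayley X)^T *m cayley X = 1%:M.
Proof.
move=> tX; have uF := unitmx_cayley_shift tX.
rewrite /cayley /= ratinvE//.
exact: cayley_isometry (mulmx_residual0 X) (cayley_shiftD tX) uF.
Qed.

Lemma add1_mulmx_cayley X : tangent X ->
  let F := cayley_shift X in
  1%:M + U^T *m cayley X = invmx (1%:M + F) *+ 2.
Proof.
move=> tX F; have uF : 1%:M + F \in unitmx := unitmx_cayley_shift tX.
rewrite /cayley /= -/F ratinvE// mulmxA mulmxDr (mulmxA U^T) UU mul1mx.
have -> : U^T *m ((X - U *m (U^T *m X)) *+ 2) = 0.
  by rewrite mulr2n mulmxDr mulmx_residual0 addr0.
rewrite addr0; apply: (can_inj (mulmxK uF)).
rewrite [LHS]mulmxDl mul1mx mulmxKV// mulr2n [RHS]mulmxDl mulVmx//.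
by rewrite addrACA subrr addr0.
Qed.

Lemma unitmx_cayley X : tangent X -> 1%:M + U^T *m cayley X \in unitmx.
Proof.
move=> tX; rewrite add1_mulmx_cayley// -scaler_nat unitmxZ ?unitfE ?pnatr_eq0//.
by rewrite unitmx_inv unitmx_cayley_shift.
Qed.

Lemma cayleyK X : tangent X -> cayley_log (cayley X) = X.
Proof.
move=> tX; rewrite /cayley_log ratinvE; last exact: unitmx_cayley.
have uF := unitmx_cayley_shift tX.
have W2 : invmx (1%:M + U^T *m cayley X) = 2^-1 *: (1%:M + cayley_shift X).
  rewrite add1_mulmx_cayley//= -scaler_nat invmxZ ?invmxK//.
  by rewrite unitmxZ ?unitfE ?pnatr_eq0// unitmx_inv.
rewrite W2.
have -> : (2^-1 *: (1%:M + cayley_shift X))^T - 2^-1 *: (1%:M + cayley_shift X) =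
    U^T *m X.
  rewrite [in LHS]linearZ /= /cayley_shift /=; move: (X - _) => B.
  have {2}-> : U^T *m X = - (X^T *m U) by apply/eqP; rewrite -addr_eq0 tX.
  rewrite !linearD linearN /= trmx1 !trmx_mul !trmxK.
  have -> : X^T *m U = - (U^T *m X) by apply/eqP; rewrite -addr_eq0 addrC tX.
  move: (B^T *m B) (U^T *m X) 1%:M => H G I.
  by apply/matrixP => i j; rewrite !mxE; field.
have -> : (cayley X - U *m (U^T *m cayley X)) *m
    (2^-1 *: (1%:M + cayley_shift X)) = X - U *m (U^T *m X).
  have -> : cayley X - U *m (U^T *m cayley X) =
      (X - U *m (U^T *m X)) *+ 2 *m invmx (1%:M + cayley_shift X).
    rewrite /cayley /= ratinvE// !mulmxA -mulmxBl; congr (_ *m _).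
    rewrite -(mulmxA U U^T X); move: (mulmx_residual0 X).
    move: (X - _) (1%:M - _) => B G UB.
    rewrite -mulmxA mulr2n !mulmxDr UB !mulmx0 !addr0 (mulmxA U^T) UU mul1mx.
    by rewrite addrC addKr.
  rewrite -scalemxAr mulmxKV// -scalerMnr scalerMnl.
  by rewrite -mulr_natr mulVf ?scale1r// pnatr_eq0.
by rewrite addrC subrK.
Qed.

Lemma cayley_log_residual (Y : 'M[R]_(n, p)) (S W : 'M[R]_p) :
  let X := U *m S + (Y - U *m (U^T *m Y)) *m W in
  U^T *m X = S /\ X - U *m (U^T *m X) = (Y - U *m (U^T *m Y)) *m W.
Proof.
have UX : U^T *m (U *m S + (Y - U *m (U^T *m Y)) *m W) = S.
  by rewrite mulmxDr !(mulmxA U^T) UU mul1mx mulmx_residual0 mul0mx addr0.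
by split=> //=; rewrite UX addrC addKr.
Qed.

Lemma cayley_logK Y : Y^T *m Y = 1%:M -> 1%:M + U^T *m Y \in unitmx ->
  tangent (cayley_log Y) /\ cayley (cayley_log Y) = Y.
Proof.
move=> YY uW; rewrite /cayley_log ratinvE//.
set V := U^T *m Y in uW *; set W := invmx (1%:M + V).
have [] := cayley_log_residual Y (W^T - W) W; rewrite -/V; set X := U *m _ + _ => UX BX.
have tX : tangent X.
  rewrite /tangent -[X^T *m U]trmxK trmx_mul trmxK UX.
  by rewrite linearB /= trmxK addrA subrK subrr.
have shiftE : cayley_shift X = W *+ 2 - 1%:M.
  rewrite /cayley_shift /= BX UX trmx_mul -mulmxA (mulmxA (_ - _)^T).
  have -> : (Y - U *m V)^T *m (Y - U *m V) = 1%:M - V^T *m V.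
    rewrite [(_ - _)^T]linearB /= trmx_mul mulmxBl !mulmxBr YY -!mulmxA.
    rewrite (mulmxA U^T U) UU mul1mx.
    by rewrite (mulmxA Y^T) -[Y^T *m U]trmxK trmx_mul trmxK -/V subrr subr0.
  (* Multiplied by [W^T] on the left and [W] on the right, this identity at [v = V] gives
     [B^T B = W + W^T - 1]; subtracting [W^T - W] leaves the shift [2 W - 1]. *)
  have -> : forall v : 'M[R]_p,
     1%:M - v^T *m v = (1%:M + v)^T + (1%:M + v) - (1%:M + v)^T *m (1%:M + v).
    move=> v; rewrite [(_ + _)^T]linearD /= trmx1 !(mulmxDl, mulmxDr) !mulmx1 !mul1mx.
    move: (v^T *m v) (v^T) (1%:M : 'M[R]_p) => a b c.
    by apply/matrixP => i j; rewrite !mxE; ring.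
  have WM : W^T *m (1%:M + V)^T = 1%:M by rewrite -trmx_mul mulmxV// trmx1.
  have MW : (1%:M + V) *m W = 1%:M by exact: mulmxV.
  rewrite mulmxBl mulmxDl mulmxBr mulmxDr -!mulmxA MW !mulmx1 (mulmxA W^T) WM mul1mx.
  by apply/matrixP => i j; rewrite !mxE; ring.
split=> //; have F1 : 1%:M + cayley_shift X = 2 *: W.
  by rewrite shiftE; apply/matrixP => i j; rewrite !mxE; ring.
have F2 : 1%:M - cayley_shift X = (1%:M - W) *+ 2.
  by rewrite shiftE; apply/matrixP => i j; rewrite !mxE; ring.
have u2 : (2 : R) \in GRing.unit by rewrite unitfE pnatr_eq0.
have uW2 : 2 *: W \in unitmx by rewrite unitmxZ// unitmx_inv.
rewrite /cayley /= F1 F2 BX ratinvE// invmxZ// invmxK -scalemxAr.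
have -> : U *m ((1%:M - W) *+ 2) + (Y - U *m V) *m W *+ 2 =
    2 *: (U *m (1%:M - W) + (Y - U *m V) *m W).
  by rewrite [in LHS]mulr2n mulmxDr -mulr2n -mulrnDl scaler_nat.
rewrite -scalemxAl scalerA mulVr// scale1r.
rewrite [LHS]mulmxDl -!mulmxA mulVmx// mulmx1.
rewrite mulmxBl mulVmx// mul1mx mulmxBr mulmxDr mulmx1.
by rewrite (addrC U) addrK addrC subrK.
Qed.

End Cayley.

(** * The tangent projector *)

(** In a rank factorization [P = C D] the equation [C D C D = C D] can be cancelled by a left
    inverse of [C] and a right inverse of [D]. *)
Lemma idempotent_base (F : fieldType) m (P : 'M[F]_m) :
  P *m P = P -> row_base P *m col_base P = 1%:M.
Proof.
move=> PP; have /row_freeP[L LR] := row_base_free P.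
have /row_fullP[K KC] := col_base_full P.
move: (mulmx_base P) KC LR; move: (col_base P) (row_base P) => C D CD KC LR.
have : K *m (C *m D *m (C *m D)) *m L = K *m (C *m D) *m L by rewrite CD PP.
by rewrite !mulmxA KC !mul1mx -!mulmxA LR !mulmx1.
Qed.

Lemma rank_idempotent (F : fieldType) m (P : 'M[F]_m) :
  P *m P = P -> \tr P = (\rank P)%:R.
Proof.
move=> /idempotent_base RC.
by rewrite -{1}(mulmx_base P) mxtrace_mulC RC mxtrace1.
Qed.

(** Linear coordinates on the image of [P]: [C] embeds the coordinate space onto the image, and [D]
    reads coordinates off. *)
Lemma idempotent_split (F : fieldType) m d (P : 'M[F]_m) :
  P *m P = P -> \rank P = d ->
  exists (C : 'M[F]_(m, d)) (D : 'M[F]_(d, m)), P = C *m D /\ D *m C = 1%:M.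
Proof.
move=> PP <-; exists (col_base P), (row_base P).
by rewrite mulmx_base; split=> //; exact: idempotent_base.
Qed.

Section TangentProjector.
Context {R : realType} {n p : nat}.
Implicit Types (U X Y : 'M[R]_(n, p)).

Lemma sum_mxtens (V : nmodType) (F : 'I_(p * n) -> V) :
  \sum_a F a = \sum_i \sum_k F (mxtens_index (i, k)).
Proof.
rewrite pair_big /= (reindex (@mxtens_index p n)) /=; last first.
  by exists (@mxtens_unindex p n) => a _; [exact: mxtens_indexK|exact: mxtens_unindexK].
by apply: eq_bigr => -[].
Qed.

Lemma vecE X i k : vec X (mxtens_index (i, k)) 0 = X k i.
Proof. by rewrite mxE mxtens_indexK. Qed.

Lemma vec_tr_mul X Y : ((vec X)^T *m vec Y) 0 0 = \tr (X^T *m Y).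
Proof.
rewrite mxE sum_mxtens; apply: eq_bigr => i _; rewrite mxE.
by apply: eq_bigr => k _; rewrite [(vec X)^T _ _]mxE !vecE [X^T _ _]mxE.
Qed.

(** On matrices this is the map sending [X] to [X - U (U^T X + X^T U) / 2], which removes [U] times
    the symmetric part of [U^T X]; [Lambda U] encodes [X] going to [U X^T U]. *)
Definition tangent_projector U : 'M[R]_(p * n) :=
  1%:M - 2^-1 *: (1%:M *t (U *m U^T) + Lambda U).

Lemma LambdaE U i k j l :
  Lambda U (mxtens_index (i, k)) (mxtens_index (j, l)) = U k j * U l i.
Proof.
rewrite mxE !mxtens_indexK mxE (bigD1 ord0)//= big1 ?addr0 ?mxE//.
by move=> x; rewrite ord1.
Qed.

Lemma mul_tensmx_vec (A : 'M[R]_n) X : (1%:M *t A) *m vec X = vec (A *m X).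
Proof.
apply/colP => a; case: (mxtens_indexP a) => i k.
rewrite vecE !mxE sum_mxtens (bigD1 i)//= [X in _ + X]big1 ?addr0 => [|j ji].
  by apply: eq_bigr => l _; rewrite tensmxE vecE !mxE eqxx mul1r.
by apply: big1 => l _; rewrite tensmxE !mxE eq_sym (negPf ji) !mul0r.
Qed.

Lemma mul_Lambda_vec U X : Lambda U *m vec X = vec (U *m X^T *m U).
Proof.
apply/colP => a; case: (mxtens_indexP a) => i k.
rewrite vecE !mxE sum_mxtens exchange_big /=; apply: eq_bigr => l _.
rewrite mxE mulr_suml; apply: eq_bigr => j _.
by rewrite LambdaE vecE mxE mulrAC.
Qed.

Lemma mul_tangent_projector U X :
  tangent_projector U *m vec X =
  vec (X - 2^-1 *: (U *m (U^T *m X + X^T *m U))).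
Proof.
rewrite mulmxBl mul1mx -scalemxAl mulmxDl mul_tensmx_vec mul_Lambda_vec.
rewrite mulmxDr !mulmxA; apply/colP => a; rewrite !mxE.
by [].
Qed.

Lemma tangent_projector_id U X : tangent U X -> tangent_projector U *m vec X = vec X.
Proof. by move=> tX; rewrite mul_tangent_projector tX mulmx0 scaler0 subr0. Qed.

(** With [S = U^T X + X^T U], which is symmetric, [U^T (X - U S / 2)] is [U^T X - S / 2]; adding its
    transpose gives [S - S]. *)
Lemma tangent_tangent_projector U (v : 'cV[R]_(p * n)) : U^T *m U = 1%:M ->
  tangent U (unvec (tangent_projector U *m v)).
Proof.
move=> UU; rewrite -[v]unvecK mul_tangent_projector vecK; move: (unvec v) => X.
set S := U^T *m X + X^T *m U.
have ST : S^T = S by rewrite linearD /= !trmx_mul !trmxK addrC.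
rewrite /tangent.
have -> : (X - 2^-1 *: (U *m S))^T = X^T - 2^-1 *: (S *m U^T).
  by rewrite linearB /= linearZ /= trmx_mul ST.
rewrite mulmxBr mulmxBl -scalemxAr -scalemxAl (mulmxA U^T) -(mulmxA S) UU mul1mx mulmx1.
rewrite addrACA -/S -opprD -scalerDl.
have -> : 2^-1 + 2^-1 = 1 :> R by field.
by rewrite scale1r subrr.
Qed.

(** The image consists of tangent vectors, and these are fixed; the identity is read off column by
    column on [delta_mx b 0]. *)
Lemma tangent_projector_idem U : U^T *m U = 1%:M ->
  tangent_projector U *m tangent_projector U = tangent_projector U.
Proof.
move=> UU; apply/matrixP => a b.
have := tangent_projector_id (tangent_tangent_projector (delta_mx b 0) UU).
rewrite unvecK mulmxA -!colE => /colP/(_ a).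
by rewrite [LHS]mxE [RHS]mxE.
Qed.

Lemma trmx_tangent_projector U : (tangent_projector U)^T = tangent_projector U.
Proof.
rewrite linearB /= trmx1 linearZ /= linearD /= trmx_tens trmx1 trmx_mul trmxK.
congr (_ - _ *: (_ + _)); apply/matrixP => a b.
case: (mxtens_indexP a) => i k; case: (mxtens_indexP b) => j l.
by rewrite [LHS]mxE !LambdaE mulrC.
Qed.

(** [Lambda U] has trace [tr(U^T U) = p], and the Kronecker product has trace
    [p tr(U U^T) = p * p]. *)
Lemma mxtrace_tangent_projector U : U^T *m U = 1%:M ->
  \tr (tangent_projector U) = (p * n)%:R - 2^-1 * (p * p.+1)%:R.
Proof.
move=> UU; rewrite linearB /= mxtrace1 linearZ /= linearD /=.
congr (_ - _ * _); rewrite mulnS natrD addrC; congr (_ + _).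
  transitivity (\tr (U^T *m U)); last by rewrite UU mxtrace1.
  rewrite /mxtrace !sum_mxtens; apply: eq_bigr => i _.
  by rewrite mxE; apply: eq_bigr => k _; rewrite LambdaE mxE.
rewrite /mxtrace !sum_mxtens natrM.
transitivity (\sum_(i < p) \tr (U *m U^T)).
  by apply: eq_bigr => i _; apply: eq_bigr => k _; rewrite tensmxE mxE eqxx mul1r.
by rewrite mxtrace_mulC UU mxtrace1 sumr_const card_ord mulr_natl.
Qed.

Lemma rank_tangent_projector U : U^T *m U = 1%:M ->
  \rank (tangent_projector U) = stiefel_dim n p.
Proof.
move=> UU; apply/eqP; rewrite -(eqr_nat R).
rewrite -rank_idempotent ?tangent_projector_idem// mxtrace_tangent_projector//.
(* The subtraction and the halving in [stiefel_dim] are those of natural numbers: [pn] and [arith]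
   show that nothing is truncated, [half2] that [p * p.+1] is even. *)
have pn : (p <= n)%N.
  by rewrite -[p](@mxrank1 R) -UU (leq_trans (mxrankM_maxl _ _))// rank_leq_col.
have arith q m : (q <= m)%N -> ((q * q.+1)./2 <= m * q)%N.
  move=> qm; rewrite -[(m * q)%N]doubleK half_leq// -mul2n mulnA mulnC leq_mul2r.
  by case: q qm => // q qm; rewrite /= mul2n -addnn -addn1 leq_add// (leq_trans _ qm).
rewrite /stiefel_dim natrB ?arith// mulnC; apply/eqP; congr (_ - _).
have half2 : ((p * p.+1)./2).*2 = (p * p.+1)%N.
  by rewrite even_halfK// oddM /= andbN.
by rewrite -[in LHS]half2 -mul2n natrM mulKf ?pnatr_eq0.
Qed.

End TangentProjector.

(** * A chart around every point *)

Section EntrywiseCayley.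
Context {R : realType} {T : Type} {n p : nat} (P : (T -> R) -> Prop).
Context (subP : function_subring P) (U : 'M[R]_(n, p)).

(** The reciprocal of the determinant is the only non-polynomial ingredient, so its membership in
    [P] is a separate hypothesis, discharged by nonvanishing of the determinant. *)
Lemma entrywise_ratinv (M : T -> 'M[R]_p) : entrywise P M ->
  P (fun x => (\det (M x))^-1) -> entrywise P (fun x => ratinv (M x)).
Proof. by move=> PM PV; apply: entrywiseZ => //; exact: entrywise_adj. Qed.

Lemma entrywise_cayley_shift (X : T -> 'M[R]_(n, p)) : entrywise P X ->
  entrywise P (fun x => cayley_shift U (X x)).
Proof.
move=> PX; have cU m1 m2 (A : 'M[R]_(m1, m2)) : entrywise P (fun _ : T => A).
  exact: entrywise_cst.
have PA : entrywise P (fun x => U^T *m X x) by exact: entrywise_mul.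
have PB : entrywise P (fun x => X x - U *m (U^T *m X x)).
  by apply: entrywiseB => //; exact: entrywise_mul.
apply: entrywiseB => //; apply: entrywise_mul => //; exact: entrywise_tr.
Qed.

Lemma entrywise_cayley (X : T -> 'M[R]_(n, p)) : entrywise P X ->
  P (fun x => (\det (1%:M + cayley_shift U (X x)))^-1) ->
  entrywise P (fun x => cayley U (X x)).
Proof.
move=> PX PV; have cU m1 m2 (A : 'M[R]_(m1, m2)) : entrywise P (fun _ : T => A).
  exact: entrywise_cst.
have PF := entrywise_cayley_shift PX.
have PB : entrywise P (fun x => X x - U *m (U^T *m X x)).
  by apply: entrywiseB => //; do 2!apply: entrywise_mul => //.
apply: entrywise_mul => //; last first.
  by apply: entrywise_ratinv => //; exact: entrywiseD.
apply: entrywiseD => //; last exact: entrywiseD.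
by apply: entrywise_mul => //; exact: entrywiseB.
Qed.

Lemma entrywise_cayley_log (Y : T -> 'M[R]_(n, p)) : entrywise P Y ->
  P (fun x => (\det (1%:M + U^T *m Y x))^-1) ->
  entrywise P (fun x => cayley_log U (Y x)).
Proof.
move=> PY PV; have cU m1 m2 (A : 'M[R]_(m1, m2)) : entrywise P (fun _ : T => A).
  exact: entrywise_cst.
have PA : entrywise P (fun x => U^T *m Y x) by exact: entrywise_mul.
have PW : entrywise P (fun x => ratinv (1%:M + U^T *m Y x)).
  by apply: entrywise_ratinv => //; exact: entrywiseD.
apply: entrywiseD => //; apply: entrywise_mul => //.
  by apply: entrywiseB => //; exact: entrywise_tr.
by apply: entrywiseB => //; exact: entrywise_mul.
Qed.

End EntrywiseCayley.

Section CayleyChart.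
Context {R : realType} {n p d : nat} (U : 'M[R]_(n, p)) (UU : U^T *m U = 1%:M).
Context (C : 'M[R]_(p * n, d)) (D : 'M[R]_(d, p * n)).
Hypotheses (CD : tangent_projector U = C *m D) (DC : D *m C = 1%:M).

Let tan (x : 'cV[R]_d) : 'M[R]_(n, p) := unvec (C *m x).

(** [D C = 1] makes the projector [C D] fix [C x], which therefore lies in its image. *)
Lemma tangent_chart x : tangent U (tan x).
Proof.
rewrite /tan -[C *m x]mul1mx.
have -> : 1%:M *m (C *m x) = tangent_projector U *m (C *m x).
  by rewrite CD mul1mx !mulmxA -(mulmxA C) DC mulmx1.
exact: tangent_tangent_projector.
Qed.

Lemma chart_subproof x : cayley U (tan x) \in stiefel R n p.
Proof. by rewrite inE /stiefel /=; apply: cayley_stiefel => //; exact: tangent_chart. Qed.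

Definition cayley_chart (x : 'cV[R]_d) : stiefel R n p := SigSub (chart_subproof x).

Let log (Y : 'M[R]_(n, p)) : 'cV[R]_d := D *m vec (cayley_log U Y).

Lemma cayley_chartK x : log (\val (cayley_chart x)) = x.
Proof.
rewrite /log /= cayleyK//; last exact: tangent_chart.
by rewrite unvecK mulmxA DC mul1mx.
Qed.

Lemma log_chartK (Y : stiefel R n p) : 1%:M + U^T *m \val Y \in unitmx ->
  cayley_chart (log (\val Y)) = Y.
Proof.
move=> uY; apply/val_inj; rewrite /= /tan /log.
have [tX] := cayley_logK UU (set_valP Y) uY.
by rewrite mulmxA -CD tangent_projector_id// vecK.
Qed.

Lemma smooth_cayley_chart : smooth_on setT (fun x => \val (cayley_chart x)).
Proof.
apply: smooth_onT_mx => /=.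
have sP := @smooth_function_subring R 'cV[R]_d.
have sX : entrywise (@smooth_on R 'cV[R]_d R setT) tan.
  move=> i j; under eq_fun do rewrite mxE.
  apply: (entrywise_mul sP); first exact: entrywise_cst.
  by move=> k l; exact: smooth_onT_coord.
apply: (entrywise_cayley sP) => // k.
apply: Ck_onTV => [x|].
  by have := unitmx_cayley_shift (tangent_chart x); rewrite unitmxE unitfE.
have sF : entrywise (@smooth_on R 'cV[R]_d R setT)
    (fun x => 1%:M + cayley_shift U (tan x)).
  apply: (entrywiseD sP); first exact: entrywise_cst.
  exact: entrywise_cayley_shift.
exact: (subring_det sP sF).
Qed.

Lemma differentiable_det Y : differentiable (fun Y => \det (1%:M + U^T *m Y)) Y.
Proof.
have dP := differentiable_function_subring Y.
apply: (subring_det dP); apply: (entrywiseD dP); first exact: entrywise_cst.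
apply: (entrywise_mul dP); first exact: entrywise_cst.
by move=> i j; exact: differentiable_coord.
Qed.

Lemma differentiable_log Y : 1%:M + U^T *m Y \in unitmx -> differentiable log Y.
Proof.
move=> uY; have dP := differentiable_function_subring Y.
apply: differentiable_mx; apply: (entrywise_mul dP); first exact: entrywise_cst.
move=> a j; under eq_fun do rewrite mxE.
apply: (entrywise_cayley_log dP); first by move=> ? ?; exact: differentiable_coord.
apply: differentiableV; first exact: differentiable_det.
by rewrite -unitfE -unitmxE.
Qed.

Lemma local_parametrization_cayley_chart : local_parametrization setT cayley_chart.
Proof.
have uY x : 1%:M + U^T *m \val (cayley_chart x) \in unitmx.
  by apply: unitmx_cayley => //; exact: tangent_chart.
split.
- exact: openT.
- exact: smooth_cayley_chart.
(* Differentiating [log \o cayley_chart = id] gives a left inverse of the differential, whence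
   injectivity. *)
- move=> x _ v w eq_vw.
  have dphi : differentiable (fun y => \val (cayley_chart y)) x.
    by have [dphi _] := smooth_cayley_chart 1; exact: dphi.
  have idE : log \o (fun y => \val (cayley_chart y)) = id.
    by apply/funext => y /=; exact: cayley_chartK.
  have dlog := differentiable_log (uY x).
  have := diff_comp dphi dlog; rewrite idE => dE.
  have di (z : 'cV[R]_d) : 'd (@id 'cV[R]_d) x z = z by rewrite diff_val.
  by rewrite -[v]di -[w]di dE /= eq_vw.
- by move=> x y _ _ eq_xy; rewrite -[x]cayley_chartK -[y]cayley_chartK eq_xy.
move=> W oW _.
(* The image of [W] is the trace on the Stiefel manifold of [O], which is open in matrix space:
   invertibility is an open condition, and [log] is continuous where it holds. *)
pose O := [set Y : 'M[R]_(n, p) | 1%:M + U^T *m Y \in unitmx /\ W (log Y)].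
have oO : open O.
  rewrite openE => Y [uY' WY]; apply: filterI.
    have d0 : \det (1%:M + U^T *m Y) != 0 by rewrite -unitfE -unitmxE.
    have near_neq0 := cvgr_neq0 (FF := nbhs_filter Y) _
      (differentiable_continuous (differentiable_det Y)) d0.
    by apply: filterS near_neq0 => Z; rewrite -unitfE -unitmxE.
  have /= := differentiable_continuous (differentiable_log uY').
  by apply; exact: open_nbhs_nbhs.
exists O => //.
apply/seteqP; split=> [Y [uY' WY]|_ [x Wx <-]].
  by exists (log (\val Y)) => //; exact: log_chartK.
by split; [exact: uY|rewrite cayley_chartK].
Qed.

End CayleyChart.

(** * The Laplace-Beltrami operator of an immersion *)

Lemma cV_dotE (R : pzSemiRingType) m (u v : 'cV[R]_m) :
  (u^T *m v) 0 0 = \sum_a u a 0 * v a 0.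
Proof. by rewrite mxE; apply: eq_bigr => a _; rewrite mxE. Qed.

Section ChainRule.
Context {R : realType} {d N : nat}.
Implicit Types (x y : 'cV[R]_d) (Phi : 'cV[R]_d -> 'cV[R]_N).

Lemma near_eq_partial i (f g : 'cV[R]_d -> R) x :
  (\forall y \near x, f y = g y) -> partial i f x = partial i g x.
Proof. by move=> fg; rewrite /partial (near_eq_derive _ fg). Qed.

Lemma partialD i (f g : 'cV[R]_d -> R) x :
  differentiable f x -> differentiable g x ->
  partial i (fun y => f y + g y) x = partial i f x + partial i g x.
Proof.
by move=> df dg; rewrite /partial deriveD//; exact: diff_derivable.
Qed.

Lemma partialM i (f g : 'cV[R]_d -> R) x :
  differentiable f x -> differentiable g x ->
  partial i (fun y => f y * g y) x = f x * partial i g x + g x * partial i f x.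
Proof.
by move=> df dg; rewrite /partial deriveM//; exact: diff_derivable.
Qed.

Lemma partial_sum m i (f : 'I_m -> 'cV[R]_d -> R) x :
  (forall a, differentiable (f a) x) ->
  partial i (fun y => \sum_a f a y) x = \sum_a partial i (f a) x.
Proof.
move=> df; rewrite -fct_sumE /partial derive_sum// => a.
exact: diff_derivable.
Qed.

Definition jacobian_mx Phi y : 'M[R]_(N, d) :=
  \matrix_(a, i) partial i (fun z => Phi z a 0) y.

Lemma partial_comp (F : 'cV[R]_N -> R) Phi y i :
  differentiable Phi y -> differentiable F (Phi y) ->
  partial i (fun z => F (Phi z)) y =
  \sum_a partial a F (Phi y) * partial i (fun z => Phi z a 0) y.
Proof.
move=> dPhi dF; have dFPhi := differentiable_comp dPhi dF.
rewrite /partial (deriveE _ dFPhi) diff_comp//= -(deriveE _ dPhi).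
have -> : 'D_(delta_mx i 0) Phi y =
    \sum_a 'D_(delta_mx i 0) (fun z => Phi z a 0) y *: delta_mx a 0.
  rewrite derive_mx; last exact: diff_derivable.
  rewrite [LHS]matrix_sum_delta; apply: eq_bigr => a _.
  by rewrite big_ord1 mxE.
rewrite linear_sum; apply: eq_bigr => a _.
by rewrite linearZ /= -deriveE// mulrC.
Qed.

End ChainRule.

Section ImmersedLaplaceBeltrami.
Context {R : realType} {d N : nat} (Phi : 'cV[R]_d -> 'cV[R]_N) (x : 'cV[R]_d).
Hypothesis dPhi : \forall y \near x, forall a, differentiable (fun z => Phi z a 0) y.
Hypothesis ddPhi : forall a j, differentiable (partial j (fun z => Phi z a 0)) x.

(* J and H are variables with defining equations, not definitions: unification
   would otherwise unfold the limits inside their entries. *)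
Context (J : 'M[R]_(N, d)) (H : 'I_d -> 'I_d -> 'cV[R]_N).
Hypothesis JE : forall i a, J a i = partial i (fun z => Phi z a 0) x.
Hypothesis HE : forall i j a,
  H i j a 0 = partial i (partial j (fun z => Phi z a 0)) x.

Lemma second_partialC i j : H i j = H j i.
Proof.
apply/colP => a; rewrite !HE.
have da : \forall y \near x, differentiable (fun z => Phi z a 0) y.
  by apply: filterS dPhi => y; exact.
rewrite /partial.
exact: (deriveC da (ddPhi a j) (ddPhi a i)).
Qed.

Definition pullback_metric y : 'M[R]_d := (jacobian_mx Phi y)^T *m jacobian_mx Phi y.

Let g := pullback_metric.

Lemma partial_metric i j l :
  partial i (fun y => g y j l) x =
  ((H i j)^T *m col l J) 0 0 + ((H i l)^T *m col j J) 0 0.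
Proof.
have -> : (fun y => g y j l) = (fun y =>
    \sum_a partial j (fun z => Phi z a 0) y * partial l (fun z => Phi z a 0) y).
  apply/funext => y; rewrite mxE; apply: eq_bigr => a _.
  by rewrite [_^T _ _]mxE [jacobian_mx _ _ _ _]mxE [jacobian_mx _ _ _ _]mxE.
rewrite partial_sum => [|a]; last exact: differentiableM.
rewrite !cV_dotE -big_split /=; apply: eq_bigr => a _.
rewrite (partialM _ (ddPhi a j) (ddPhi a l)).
rewrite !HE ![col _ _ _ _]mxE !JE.
by rewrite addrC; congr (_ + _); rewrite mulrC.
Qed.

(** Expanding the three metric derivatives gives six inner products; symmetry of [H] cancels four
    and leaves twice that of [H i j] with column [l] of [J]. The symbols are thus the coordinates of
    the tangential part of [H i j]. *)
Lemma christoffelE k i j :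
  christoffel g k i j x = (invmx (g x) *m J^T *m H i j) k 0.
Proof.
rewrite /christoffel -mulmxA mxE mulr_sumr; apply: eq_bigr => l _.
rewrite !partial_metric (second_partialC j i) (second_partialC l i) (second_partialC l j).
have -> : (J^T *m H i j) l 0 = ((H i j)^T *m col l J) 0 0.
  rewrite cV_dotE mxE; apply: eq_bigr => a _.
  by rewrite [col _ _ _ _]mxE [J^T _ _]mxE mulrC.
by field.
Qed.

Context (F : 'cV[R]_N -> R).
Hypothesis dF : forall z, differentiable F z.
Hypothesis ddF : forall a z, differentiable (partial a F) z.

Let grad := euclidean_gradient F (Phi x).
Let hess := euclidean_hessian F (Phi x).

Let dPhi' : \forall y \near x, differentiable Phi y.
Proof.
apply: filterS dPhi => y dy; apply: differentiable_mx => a j.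
by rewrite ord1.
Qed.

Lemma partial_immersed k : partial k (fun y => F (Phi y)) x = (grad^T *m J) 0 k.
Proof.
rewrite partial_comp//; last exact: nbhs_singleton dPhi'.
by rewrite mxE; apply: eq_bigr => a _; rewrite JE [grad^T _ _]mxE [grad _ _]mxE.
Qed.

Lemma partial2_immersed i j :
  partial i (partial j (fun y => F (Phi y))) x =
  (J^T *m hess *m J) i j + (grad^T *m H i j) 0 0.
Proof.
rewrite (@near_eq_partial _ _ _ _ (fun y => \sum_a partial a F (Phi y) *
  partial j (fun z => Phi z a 0) y)); last first.
  by apply: filterS dPhi' => y dy; exact: partial_comp.
have dPx : differentiable Phi x by exact: nbhs_singleton dPhi'.
have dFP a : differentiable (fun y => partial a F (Phi y)) x.
  exact: (differentiable_comp dPx).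
rewrite partial_sum => [|a]; last exact: differentiableM.
rewrite cV_dotE mxE -big_split /=; apply: eq_bigr => a _.
rewrite (partialM _ (dFP a) (ddPhi a j)) addrC HE [grad _ _]mxE JE; congr (_ + _).
rewrite (partial_comp _ dPx (ddF a (Phi x))) mulrC; congr (_ * _); rewrite mxE.
by apply: eq_bigr => b _; rewrite -JE [J^T _ _]mxE [hess _ _]mxE mulrC.
Qed.

Lemma coord_laplace_beltrami_immersed :
  let Pi := J *m invmx (g x) *m J^T in
  coord_laplace_beltrami g (fun y => F (Phi y)) x =
  \tr (Pi *m hess) +
  \sum_i \sum_j invmx (g x) i j * (grad^T *m (1%:M - Pi) *m H i j) 0 0.
Proof.
move=> Pi; rewrite /coord_laplace_beltrami.
(* The Christoffel correction is [grad^T Pi H i j], so only the normal part of [H i j] survives next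
   to the second-order term. *)
have -> : riemannian_hessian g (fun y => F (Phi y)) x =
  J^T *m hess *m J + \matrix_(i, j) (grad^T *m (1%:M - Pi) *m H i j) 0 0.
  apply/matrixP => i j; rewrite [LHS]mxE [RHS]mxE [X in _ = _ + X]mxE.
  rewrite partial2_immersed -addrA; congr (_ + _).
  rewrite mulmxBr mulmx1 mulmxBl [RHS]mxE [X in _ = _ + X]mxE; congr (_ - _).
  rewrite /Pi -!mulmxA (mulmxA grad^T) [RHS]mxE; apply: eq_bigr => k _.
  by rewrite christoffelE partial_immersed mulrC !mulmxA.
rewrite mulmxDr linearD /=; congr (_ + _).
  by rewrite mxtrace_mulC -!mulmxA mxtrace_mulC mulmxA /Pi -!mulmxA mxtrace_mulC !mulmxA.
rewrite /mxtrace; apply: eq_bigr => i _; rewrite mxE; apply: eq_bigr => j _.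
by rewrite !mxE second_partialC.
Qed.

End ImmersedLaplaceBeltrami.

(** * Charts of the Stiefel manifold *)

(** [g] inherits the first-order expansion of [f] at [x], and uniqueness of the differential
    identifies its linear part with ['d g x]. *)
Lemma near_eq_differentiable (R : realType) (V W : normedModType R)
    (f g : V -> W) (x : V) :
  (\forall y \near x, f y = g y) -> differentiable f x -> differentiable g x.
Proof.
move=> fg /diff_locallyP[cdf ff].
have gg : g \o shift x = cst (g x) + 'd f x +o_ 0 id.
  apply/eqaddoP => e e0; move/eqaddoP : ff => /(_ e e0).
  have fg0 : \forall h \near (0 : V), f (h + x) = g (h + x).
    by have := fg; rewrite (near_shift 0) /= subr0.
  by apply: filterS2 fg0 => h; rewrite /= -(nbhs_singleton fg) /= !fctE => <-.
have dg := diff_unique cdf gg.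
by apply/diff_locallyP; rewrite dg.
Qed.

(** The metric enters only through its value and first derivatives at [x]. This allows replacing
    [induced_metric] by [pullback_metric], their equality being established only on the chart
    domain. *)
Lemma coord_laplace_beltrami_near (R : realType) d (g1 g2 : 'cV[R]_d -> 'M[R]_d)
    (h : 'cV[R]_d -> R) x : (\forall y \near x, g1 y = g2 y) ->
  coord_laplace_beltrami g1 h x = coord_laplace_beltrami g2 h x.
Proof.
move=> g12; have g12x := nbhs_singleton g12.
have pg i j l : partial i (fun y => g1 y j l) x = partial i (fun y => g2 y j l) x.
  by apply: near_eq_partial; apply: filterS g12 => y ->.
rewrite /coord_laplace_beltrami g12x; congr (\tr (_ *m _)).
apply/matrixP => i j; rewrite !mxE; congr (_ - _); apply: eq_bigr => k _.
by rewrite /christoffel g12x; do 2!congr (_ * _); apply: eq_bigr => l _; rewrite !pg.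
Qed.

Lemma gram_unit (R : realType) m d (J : 'M[R]_(m, d)) :
  (forall v : 'cV[R]_d, J *m v = 0 -> v = 0) -> J^T *m J \in unitmx.
Proof.
move=> injJ; rewrite -row_free_unit -kermx_eq0; apply/eqP/row_matrixP => i.
rewrite row0; move: (row i _) (row_sub i (kermx (J^T *m J))) => v /sub_kermxP vJ.
apply/trmx_inj; rewrite trmx0; apply/injJ/gram_eq0.
by rewrite trmx_mul trmxK -mulmxA (mulmxA J^T) mulmxA vJ mul0mx.
Qed.

(** [P J = J] puts the range of [Pi] inside that of [P]. Conversely [J = C (D J)] with [D J] square
    and left invertible, so the columns of [C] are combinations of those of [J] and [Pi P = P].
    Transposing [P Pi = Pi] then gives [Pi = Pi P = P]. *)
Lemma orthogonal_projector_unique (R : realType) m d (P : 'M[R]_m)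
    (J C : 'M[R]_(m, d)) (D : 'M[R]_(d, m)) :
  P^T = P -> P = C *m D -> P *m J = J -> J^T *m J \in unitmx ->
  J *m invmx (J^T *m J) *m J^T = P.
Proof.
move=> PT PCD PJ ug; set Pi := _ *m J^T.
have PiT : Pi^T = Pi by rewrite /Pi !trmx_mul trmx_inv trmx_mul !trmxK mulmxA.
have PiJ : Pi *m J = J by rewrite /Pi -!mulmxA mulVmx// mulmx1.
have PPi : P *m Pi = Pi by rewrite /Pi !mulmxA PJ.
have JE : C *m (D *m J) = J by rewrite mulmxA -PCD.
have uY : D *m J \in unitmx.
  have : (invmx (J^T *m J) *m J^T *m C) *m (D *m J) = 1%:M.
    by rewrite -!mulmxA JE mulVmx.
  by move=> /mulmx1_unit[].
have PiC : Pi *m C = C by apply: (can_inj (mulmxK uY)); rewrite -mulmxA JE.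
have PiP : Pi *m P = P by rewrite PCD mulmxA PiC.
by rewrite -PiT -PPi trmx_mul PiT PT PiP.
Qed.

Definition vec_chart (R : realType) (n p d : nat) (phi : 'cV[R]_d -> stiefel R n p)
  (y : 'cV[R]_d) : 'cV[R]_(p * n) := vec (\val (phi y)).

Section StiefelChart.
Context {R : realType} {n p d : nat} (V : set 'cV[R]_d) (phi : 'cV[R]_d -> stiefel R n p).
Context (x : 'cV[R]_d) (lphi : local_parametrization V phi) (Vx : V x).

Local Notation Phi := (vec_chart phi).

Lemma vec_chartE y k b : Phi y (mxtens_index (b, k)) 0 = (\val (phi y)) k b.
Proof. exact: vecE. Qed.

Lemma chart_orthonormal y : (\val (phi y))^T *m \val (phi y) = 1%:M.
Proof. exact: set_valP (phi y). Qed.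

Lemma near_chart_domain : \forall y \near x, V y.
Proof. by case: lphi => oV _ _ _ _; exact: open_nbhs_nbhs. Qed.

Lemma differentiable_chart y : V y -> differentiable (fun z => \val (phi z)) y.
Proof. by case: lphi => _ /(_ 1)[dphi _] _ _ _; exact: dphi. Qed.

Lemma differentiable_chart_coord y a : V y -> differentiable (fun z => Phi z a 0) y.
Proof.
move=> Vy; rewrite /vec_chart; under eq_fun do rewrite mxE.
exact: (differentiable_comp (differentiable_chart Vy) (differentiable_coord _ _ _)).
Qed.

Lemma partial_chart_coord y a j : V y ->
  partial j (fun z => Phi z a 0) y = vec (partial j (fun z => \val (phi z)) y) a 0.
Proof.
move=> Vy; rewrite /vec_chart; under eq_fun do rewrite mxE.
rewrite /partial derive_mx ?mxE//.
exact/diff_derivable/differentiable_chart.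
Qed.

Lemma differentiable_partial_chart_coord a j :
  differentiable (partial j (fun z => Phi z a 0)) x.
Proof.
apply: (@near_eq_differentiable _ _ _
  (fun y => vec (partial j (fun z => \val (phi z)) y) a 0)).
  by apply: filterS near_chart_domain => y Vy; rewrite partial_chart_coord.
under eq_fun do rewrite mxE.
have dd : differentiable (partial j (fun z => \val (phi z))) x.
  by case: lphi => _ /(_ 2)[_ /(_ (delta_mx j 0))[ddphi _]] _ _ _; exact: ddphi.
exact: (differentiable_comp dd (differentiable_coord _ _ _)).
Qed.

Lemma induced_metricE y : V y -> induced_metric phi y = pullback_metric Phi y.
Proof.
move=> Vy; apply/matrixP => i j; rewrite mxE /frobenius -vec_tr_mul !mxE.
by apply: eq_bigr => a _; rewrite 3![in RHS]mxE [in LHS]mxE !partial_chart_coord.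
Qed.

Lemma mul_chart_jacobian v :
  jacobian_mx Phi x *m v = vec ('d (fun z => \val (phi z)) x v).
Proof.
have dphi := differentiable_chart Vx.
have -> : 'd (fun z => \val (phi z)) x v =
    \sum_i v i 0 *: partial i (fun z => \val (phi z)) x.
  rewrite {1}[v]matrix_sum_delta linear_sum; apply: eq_bigr => i _.
  by rewrite big_ord1 linearZ /= /partial (deriveE _ dphi).
apply/colP => a; rewrite mxE [RHS]mxE summxE; apply: eq_bigr => i _.
rewrite /jacobian_mx [(\matrix_(_, _) _) _ _]mxE partial_chart_coord//.
by rewrite [vec _ _ _]mxE [RHS]mxE mulrC.
Qed.

Lemma unit_chart_metric : pullback_metric Phi x \in unitmx.
Proof.
apply: gram_unit => v Jv.
case: lphi => _ _ /(_ x Vx) injd _ _; apply: injd; rewrite linear0.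
by rewrite -[LHS]vecK -mul_chart_jacobian Jv; apply/matrixP => k i; rewrite !mxE.
Qed.

Local Notation ix := mxtens_index.

(** First derivative of the entry [(b, c)] of the orthonormality relation, which is constant along
    the chart. *)
Lemma first_constraint y (j : 'I_d) (b c : 'I_p) : V y ->
  \sum_k (Phi y (ix (b, k)) 0 * partial j (fun z => Phi z (ix (c, k)) 0) y +
          Phi y (ix (c, k)) 0 * partial j (fun z => Phi z (ix (b, k)) 0) y) = 0.
Proof.
move=> Vy.
have dPhi a : differentiable (fun z => Phi z a 0) y by exact: differentiable_chart_coord.
transitivity (partial j
  (fun z : 'cV[R]_d => \sum_k Phi z (ix (b, k)) 0 * Phi z (ix (c, k)) 0) y).
  rewrite partial_sum => [|k]; last exact: differentiableM.
  by apply: eq_bigr => k _; rewrite partialM.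
have -> : (fun z : 'cV[R]_d =>
    \sum_k Phi z (ix (b, k)) 0 * Phi z (ix (c, k)) 0) = fun=> (b == c)%:R.
  apply/funext => z; have /matrixP/(_ b c) := chart_orthonormal z.
  rewrite [RHS]mxE => <-; rewrite [RHS]mxE; apply: eq_bigr => k _.
  by rewrite !vec_chartE [X in _ = X * _]mxE.
exact: derive_cst.
Qed.

(** Derivative of [first_constraint], which holds at all points near [x] because the chart domain is
    open. *)
Lemma second_constraint (i j : 'I_d) (b c : 'I_p) :
  \sum_k (Phi x (ix (b, k)) 0 *
            partial i (partial j (fun z => Phi z (ix (c, k)) 0)) x +
          partial j (fun z => Phi z (ix (c, k)) 0) x *
            partial i (fun z => Phi z (ix (b, k)) 0) x +
          (Phi x (ix (c, k)) 0 *
            partial i (partial j (fun z => Phi z (ix (b, k)) 0)) x +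
          partial j (fun z => Phi z (ix (b, k)) 0) x *
            partial i (fun z => Phi z (ix (c, k)) 0) x)) = 0.
Proof.
have dPhi a : differentiable (fun z => Phi z a 0) x by exact: differentiable_chart_coord.
have ddPhi a := differentiable_partial_chart_coord a j.
rewrite -[RHS](_ : partial i (fun y =>
    \sum_k (Phi y (ix (b, k)) 0 * partial j (fun z => Phi z (ix (c, k)) 0) y +
            Phi y (ix (c, k)) 0 * partial j (fun z => Phi z (ix (b, k)) 0) y))
    x = 0); last first.
  rewrite (@near_eq_partial _ _ _ _ (fun=> 0)); first exact: derive_cst.
  by apply: filterS near_chart_domain => y; exact: first_constraint.
rewrite partial_sum => [|k]; last by apply: differentiableD; exact: differentiableM.
apply: eq_bigr => k _.
rewrite partialD; [|exact: differentiableM..].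
by rewrite (partialM _ (dPhi _) (ddPhi _)) (partialM _ (dPhi _) (ddPhi _)).
Qed.

End StiefelChart.

(** * The Laplacian formula in a chart of the Stiefel manifold *)

Section StiefelLaplacian.
Context {R : realType} {n p : nat}.
Implicit Types (U X Y : 'M[R]_(n, p)).

(** Source of the coefficient [n - (p + 1) / 2]: on a diagonal block the identity contributes [n],
    the Kronecker product [p], and [Lambda U] the inner product of two orthonormal columns. *)
Lemma block_trace_tangent_projector U b c : U^T *m U = 1%:M ->
  \sum_k tangent_projector U (mxtens_index (b, k)) (mxtens_index (c, k)) =
  (n%:R - p.+1%:R / 2) * (b == c)%:R.
Proof.
move=> UU.
have eqE k : (mxtens_index (b, k) == mxtens_index (c, k) :> 'I_(p * n)) = (b == c).
  by rewrite (can_eq (@mxtens_indexK p n)) xpair_eqE eqxx andbT.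
transitivity (\sum_k ((b == c)%:R - 2^-1 * ((b == c)%:R * (U *m U^T) k k
    + U k c * U k b) : R)).
  apply: eq_bigr => k _; rewrite -LambdaE.
  have -> : (b == c)%:R * (U *m U^T) k k =
      (1%:M *t (U *m U^T)) (mxtens_index (b, k)) (mxtens_index (c, k)) :> R.
    by rewrite tensmxE [1%:M _ _]mxE.
  rewrite /tangent_projector [LHS]mxE [1%:M _ _]mxE eqE.
  by rewrite [X in _ + X]mxE [X in - X]mxE [X in _ * X]mxE.
have trUU : \sum_k (U *m U^T) k k = p%:R.
  by rewrite -[LHS]/(\tr (U *m U^T)) mxtrace_mulC UU mxtrace1.
have Ucb : \sum_k U k c * U k b = (b == c)%:R.
  have /matrixP/(_ b c) := UU; rewrite [RHS]mxE => <-; rewrite mxE.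
  by apply: eq_bigr => k _; rewrite mxE mulrC.
rewrite sumrB sumr_const card_ord -mulr_natr -mulr_sumr big_split /= -mulr_sumr.
by rewrite trUU Ucb -natr1; field.
Qed.

Lemma mx_conjE m d (J : 'M[R]_(m, d)) (M : 'M[R]_d) a b :
  (J *m M *m J^T) a b = \sum_i \sum_j M i j * (J a i * J b j).
Proof.
rewrite mxE exchange_big /=; apply: eq_bigr => j _.
rewrite [(J *m M) _ _]mxE mulr_suml; apply: eq_bigr => i _.
by rewrite [J^T _ _]mxE; ring.
Qed.

(** The complementary projector sends [X] to [U S / 2] with [S = U^T X + X^T U], so the normal part
    depends on [X] only through [S], the combination that the differentiated constraint controls. *)
Lemma normal_component U X (w : 'cV[R]_(p * n)) :
  (w^T *m (1%:M - tangent_projector U) *m vec X) 0 0 =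
  2^-1 * \tr ((unvec w)^T *m U *m (U^T *m X + X^T *m U)).
Proof.
rewrite -mulmxA mulmxBl mul1mx mul_tangent_projector.
set S := U^T *m X + _.
have -> : vec X - vec (X - 2^-1 *: (U *m S)) = vec (2^-1 *: (U *m S)).
  by apply/colP => a; rewrite !mxE; ring.
by rewrite -{1}[w]unvecK vec_tr_mul -scalemxAr linearZ /= mulmxA.
Qed.

Lemma trmx_mulE m q1 q2 (X : 'M[R]_(m, q1)) (Y : 'M[R]_(m, q2)) b c :
  (X^T *m Y) b c = \sum_k X k b * Y k c.
Proof. by rewrite mxE; apply: eq_bigr => k _; rewrite mxE. Qed.

Context (d : nat) (V : set 'cV[R]_d) (phi : 'cV[R]_d -> stiefel R n p).
Context (x : 'cV[R]_d) (lphi : local_parametrization V phi) (Vx : V x).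

Local Notation U := (\val (phi x)).
Local Notation Phi := (vec_chart phi).

Context (J : 'M[R]_(p * n, d)) (H : 'I_d -> 'I_d -> 'cV[R]_(p * n)).
Hypothesis JE : forall i a, J a i = partial i (fun z => Phi z a 0) x.
Hypothesis HE : forall i j a,
  H i j a 0 = partial i (partial j (fun z => Phi z a 0)) x.

Let T j : 'M[R]_(n, p) := unvec (col j J).

Let TE j k b : T j k b = J (mxtens_index (b, k)) j.
Proof. by rewrite /T !mxE. Qed.

Lemma tangent_chart_partial j : tangent U (T j).
Proof.
apply/matrixP => b c; rewrite [RHS]mxE -[RHS](first_constraint lphi j b c Vx).
rewrite mxE !trmx_mulE -big_split /=; apply: eq_bigr => k _.
by rewrite !TE !vec_chartE -!JE [X in _ + X]mulrC.
Qed.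

Let hess i j k b : unvec (H i j) k b = H i j (mxtens_index (b, k)) 0.
Proof. by rewrite mxE. Qed.

(** Matrix form of [second_constraint]: it trades second derivatives of the chart for products of
    the coordinate tangent vectors [T]. *)
Lemma chart_second_partial i j :
  U^T *m unvec (H i j) + (unvec (H i j))^T *m U =
  - ((T i)^T *m T j + (T j)^T *m T i).
Proof.
apply/eqP; rewrite -addr_eq0; apply/eqP/matrixP => b c.
rewrite [RHS]mxE -[RHS](second_constraint lphi Vx i j b c).
have addE (A B : 'M[R]_p) : (A + B) b c = A b c + B b c by rewrite mxE.
rewrite !addE !trmx_mulE -!big_split /=; apply: eq_bigr => k _.
rewrite !hess !TE !vec_chartE -!JE -!HE.
by ring.
Qed.

Local Notation G := (invmx (pullback_metric Phi x)).

(** Weighted by the inverse metric, the entries of [(T i)^T *m T j] sum to traces of blocks of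
    [J G J^T], that is, of the tangent projector; the two transposed terms account for the
    doubling. *)
Lemma metric_trace_partials :
  J *m G *m J^T = tangent_projector U ->
  \sum_i \sum_j G i j *: ((T i)^T *m T j + (T j)^T *m T i) =
  ((n%:R - p.+1%:R / 2) *+ 2)%:M.
Proof.
move=> JGJ; have UU : U^T *m U = 1%:M by exact: chart_orthonormal.
apply/matrixP => b c; rewrite summxE [RHS]mxE.
transitivity (\sum_k ((J *m G *m J^T) (mxtens_index (b, k)) (mxtens_index (c, k)) +
   (J *m G *m J^T) (mxtens_index (c, k)) (mxtens_index (b, k)))); last first.
  rewrite JGJ big_split /= !block_trace_tangent_projector// (eq_sym c b).
  by rewrite mulr_natr -mulr2n -mulrnA mulnC mulrnA.
under [RHS]eq_bigr do rewrite !mx_conjE -big_split /=.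
rewrite exchange_big /=; apply: eq_bigr => i _.
rewrite summxE; under [RHS]eq_bigr do rewrite -big_split /=.
rewrite exchange_big /=; apply: eq_bigr => j _.
rewrite [LHS]mxE [X in _ * X]mxE !trmx_mulE -big_split mulr_sumr /=.
by apply: eq_bigr => k _; rewrite !TE; ring.
Qed.

Lemma chart_jacobianE : jacobian_mx Phi x = J.
Proof. by apply/matrixP => a i; rewrite mxE JE. Qed.

(** The columns of [J] are tangent, hence fixed by the explicit projector, whose rank equals the
    number [d] of columns. *)
Lemma chart_tangent_projector : d = stiefel_dim n p ->
  J *m G *m J^T = tangent_projector U.
Proof.
move=> dE; have UU : U^T *m U = 1%:M by exact: chart_orthonormal.
have := unit_chart_metric lphi Vx; rewrite /pullback_metric chart_jacobianE => ug.
have rk : \rank (tangent_projector U) = d by rewrite rank_tangent_projector.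
have [C [D [PCD _]]] := idempotent_split (tangent_projector_idem UU) rk.
apply: (orthogonal_projector_unique _ PCD _ ug); first exact: trmx_tangent_projector.
apply/matrixP => a j.
have := tangent_projector_id (tangent_chart_partial j).
rewrite unvecK colE mulmxA -!colE => /colP/(_ a).
by rewrite [LHS]mxE [RHS]mxE.
Qed.

Lemma chart_laplace_beltrami (F : 'cV[R]_(p * n) -> R) : d = stiefel_dim n p ->
  (forall z, differentiable F z) ->
  (forall a z, differentiable (partial a F) z) ->
  coord_laplace_beltrami (induced_metric phi) (fun y => F (Phi y)) x =
  \tr (euclidean_hessian F (Phi x))
  - (n%:R - p.+1%:R / 2) * \tr (U^T *m unvec (euclidean_gradient F (Phi x)))
  - 2^-1 * \tr ((1%:M *t (U *m U^T) + Lambda U) *m euclidean_hessian F (Phi x)).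
Proof.
move=> dE dF ddF.
rewrite (@coord_laplace_beltrami_near _ _ _ (pullback_metric Phi)); last first.
  by apply: filterS (near_chart_domain lphi Vx) => y; exact: induced_metricE.
have dPhi : \forall y \near x, forall a, differentiable (fun z => Phi z a 0) y.
  apply: filterS (near_chart_domain lphi Vx) => y Vy a.
  exact: (differentiable_chart_coord lphi).
have ddPhi := differentiable_partial_chart_coord lphi Vx.
rewrite (coord_laplace_beltrami_immersed dPhi ddPhi JE HE dF ddF) /=.
rewrite chart_tangent_projector//.
move: (euclidean_hessian F _) (euclidean_gradient F _) => h w.
rewrite {1}/tangent_projector mulmxBl mul1mx linearB /= -scalemxAl linearZ /=.
rewrite addrAC; congr (_ + _ - _).
under eq_bigr do under eq_bigr do
  rewrite -[H _ _]unvecK normal_component chart_second_partial.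
(* The double sum moves inside the trace, where [metric_trace_partials] makes it a scalar matrix;
   its factor 2 absorbs the [2^-1] of [normal_component]. *)
have linS (A : 'M[R]_p) (S : 'I_d -> 'I_d -> 'M[R]_p) :
    \sum_i \sum_j G i j * (2^-1 * \tr (A *m - S i j)) =
    - (2^-1 * \tr (A *m \sum_i \sum_j G i j *: S i j)).
  rewrite mulmx_sumr linear_sum /= mulr_sumr -sumrN; apply: eq_bigr => i _.
  rewrite mulmx_sumr linear_sum /= mulr_sumr -sumrN; apply: eq_bigr => j _.
  by rewrite mulmxN raddfN -scalemxAr mxtraceZ /=; ring.
rewrite linS metric_trace_partials ?chart_tangent_projector//.
by rewrite mul_mx_scalar mxtraceZ -[in LHS]mxtrace_tr trmx_mul trmxK mulr2n; field.
Qed.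

End StiefelLaplacian.

(** * Passing from matrices to their vectorizations *)

Lemma derive_comp_linear (R : realType) (E F G : normedModType R)
    (l : {linear E -> F}) (f : F -> G) (x v : E) :
  'D_v (fun y => f (l y)) x = 'D_(l v) f (l x).
Proof.
rewrite /derive.
rewrite (_ : (fun h => _) =
  (fun h : R => h^-1 *: ((f \o shift (l x)) (h *: l v) - f (l x)))) //.
by apply/funext => h /=; congr (_ *: (f _ - _)); rewrite linearD linearZ.
Qed.

Section Unvec.
Context {R : realType} {n p : nat}.

Lemma unvec_is_linear : linear (@unvec R n p).
Proof. by move=> a u v; apply/matrixP => k i; rewrite !mxE. Qed.

HB.instance Definition _ := GRing.isLinear.Build R _ _ _ (@unvec R n p) unvec_is_linear.

Lemma differentiable_unvec v : differentiable (@unvec R n p) v.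
Proof.
apply: differentiable_mx => k i; under eq_fun do rewrite mxE.
exact: differentiable_coord.
Qed.

Lemma smooth_unvec (f : 'M[R]_(n, p) -> R) : smooth_on setT f ->
  (forall v, differentiable (f \o @unvec R n p) v) /\
  (forall a v, differentiable (partial a (f \o @unvec R n p)) v).
Proof.
move=> sf; have [df _] := sf 1; have [_ ddf] := sf 2.
split=> [v|a v]; first exact: (differentiable_comp (differentiable_unvec v) (df _ I)).
have -> : partial a (f \o @unvec R n p) = 'D_(unvec (delta_mx a 0)) f \o @unvec R n p.
  by apply/funext => w; exact: (derive_comp_linear (@unvec R n p)).
have [dda _] := ddf (unvec (delta_mx a 0)).
exact: (differentiable_comp (differentiable_unvec v) (dda _ I)).
Qed.

End Unvec.

(** * Existence of a chart and independence of the chart *)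

Lemma exists_parametrization (R : realType) n p (U : stiefel R n p) :
  exists (phi : 'cV[R]_(stiefel_dim n p) -> stiefel R n p) x,
    local_parametrization setT phi /\ phi x = U.
Proof.
have UU : (\val U)^T *m \val U = 1%:M by exact: set_valP U.
have [C [D [CD DC]]] :=
  idempotent_split (tangent_projector_idem UU) (rank_tangent_projector UU).
(* These are the coordinates of [U] in its own chart; [log_chartK] applies since [1 + U^T U] is
   twice the identity. *)
exists (cayley_chart UU CD DC), (D *m vec (cayley_log (\val U) (\val U))).
split; first exact: local_parametrization_cayley_chart.
apply: log_chartK; rewrite UU -mulr2n -scaler_nat unitmxZ ?unitmx1//.
by rewrite unitfE pnatr_eq0.
Qed.

Unset Implicit Arguments.

Theorem theorem1p3 (R : realType) (n p : nat) (hp : (1 <= p)%N) (hnp : (p <= n)%N)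
    (ftilde : stiefel R n p -> R) (f : 'M[R]_(n, p) -> R)
    (hftilde : smooth_function (stiefel_dim n p) ftilde)
    (hf : smooth_on setT f)
    (hext : forall U : stiefel R n p, f (\val U) = ftilde U)
    (U : stiefel R n p) :
  laplace_beltrami (stiefel_dim n p) ftilde U =
    laplacian f (\val U)
    - (n%:R - p.+1%:R / 2) * \tr ((\val U)^T *m gradient f (\val U))
    - 2^-1 * \tr ((1%:M *t (\val U *m (\val U)^T) + Lambda (\val U))
                  *m hessian f (\val U)).
Proof.
have [dF ddF] := smooth_unvec hf.
(* The right-hand side mentions no chart, so this one computation shows that all coordinate
   expressions agree. *)
have chart_value V (phi : 'cV[R]_(stiefel_dim n p) -> stiefel R n p) x :
    local_parametrization V phi -> V x -> phi x = U ->
    coord_laplace_beltrami (induced_metric phi) (fun y => ftilde (phi y)) x =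
    laplacian f (\val U)
    - (n%:R - p.+1%:R / 2) * \tr ((\val U)^T *m gradient f (\val U))
    - 2^-1 * \tr ((1%:M *t (\val U *m (\val U)^T) + Lambda (\val U))
                  *m hessian f (\val U)).
  move=> lphi Vx <-.
  have -> : (fun y => ftilde (phi y)) = (fun y => (f \o @unvec R n p) (vec_chart phi y)).
    by apply/funext => y; rewrite /= /vec_chart vecK hext.
  pose J : 'M[R]_(p * n, stiefel_dim n p) :=
    \matrix_(a, i) partial i (fun z => vec_chart phi z a 0) x.
  pose H i j : 'cV[R]_(p * n) :=
    \col_a partial i (partial j (fun z => vec_chart phi z a 0)) x.
  have JE i a : J a i = partial i (fun z => vec_chart phi z a 0) x.
    by rewrite /J mxE.
  have HE i j a : H i j a 0 = partial i (partial j (fun z => vec_chart phi z a 0)) x.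
    by rewrite /H mxE.
  exact: (chart_laplace_beltrami lphi Vx JE HE (erefl _) dF ddF).
apply: get_unique => [V phi x lphi Vx phix|l lE].
  by rewrite (chart_value V).
(* The condition defining [laplace_beltrami] quantifies over charts around [U]; an actual chart
   keeps it from being vacuous and determines [l]. *)
have [phi [x [lphi phix]]] := exists_parametrization U.
by rewrite -(chart_value _ _ _ lphi I phix); exact: lE lphi I phix.
Qed.
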